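(* Let $A\in\mathbb{R}^{m\times n}$, $b\in\mathbb{R}^m$, $x_0\in\mathbb{R}^n$, and let $M_1,M_2,\ldots\in\mathbb{R}^{n\times n}$ be symmetric positive definite matrices. Let $K\ge 2$ be such that the Fast Flexible Golub-Kahan recurrence (defined in the context) applied to $A,b,x_0,M_1,M_2,\ldots$ does not stop before it has produced $v_1,\ldots,v_K$ and $z_1,\ldots,z_K$. Then for every $k$ with $2\le k\le K$, $$v_k \perp_{M_i^{-1}} v_i,\quad\text{or equivalently}\quad v_k\perp z_i,\qquad i=1,2,\ldots,k-1.$$ Consequently, with $V_k=[v_1,\ldots,v_k]$ and $Z_k=[z_1,\ldots,z_k]$, the matrix $V_k^TZ_k$ is upper triangular.
   Context: All computations are in exact arithmetic. $(x,y)=x^Ty$ is the Euclidean inner product, $\|\cdot\|$ the Euclidean norm, $x\perp y$ means $(x,y)=0$, and for a symmetric positive definite matrix $W$, $x\perp_W y$ means $(x,Wy)=0$. Fast Flexible Golub-Kahan recurrence. Input: $A,b,x_0,M_1,M_2,\ldots$. Set $r_0=b-Ax_0$, $\beta_1=\|r_0\|$, $u_1=r_0/\beta_1$, $v_0=0$. For $k=1,2,\ldots$: (1) $\hat v:=A^Tu_k-\beta_kv_{k-1}$, $\hat z:=M_k^{-1}\hat v$, $\alpha_k:=(\hat z,\hat v)^{1/2}$; (2) $v_k:=\hat v/\alpha_k$, $z_k:=\hat z/\alpha_k$ (so $z_k=M_k^{-1}v_k$); (3) $n_{j,k}:=(Az_k)^Tu_j$ for $j=1,\ldots,k$, and $\hat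 u:=Az_k-\sum_{j=1}^k n_{j,k}u_j$; (4) $\beta_{k+1}:=\|\hat u\|$, $u_{k+1}:=\hat u/\beta_{k+1}$. That the recurrence does not stop before producing $v_1,\ldots,v_K$ and $z_1,\ldots,z_K$ means that $\beta_1,\ldots,\beta_K$ and $\alpha_1,\ldots,\alpha_K$ are all nonzero. *)

(* Defs.v *)
From HB Require Import structures.
From mathcomp Require Import all_boot all_order all_algebra.
From mathcomp Require Import reals.

Set Implicit Arguments.
Unset Strict Implicit.
Unset Printing Implicit Defensive.

Import Order.TTheory GRing.Theory Num.Theory.
Local Open Scope ring_scope.

Section Euclidean.
Variables (R : realType) (n : nat).
Implicit Types (x y : 'cV[R]_n) (W : 'M[R]_n).

Definition dotp x y : R := (x^T *m y) 0 0.

(* The norm that MathComp puts on matrices is not the Euclidean one. *)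
Definition enorm x : R := Num.sqrt (dotp x x).

Definition perp x y : Prop := dotp x y = 0.

Definition perp_wrt W x y : Prop := dotp x (W *m y) = 0.

Definition spd W : Prop :=
  W^T = W /\ forall x, x != 0 -> 0 < dotp x (W *m x).

End Euclidean.

(* [is_trig_mx] means lower triangular. *)
Definition is_upper_trig_mx (R : realType) (p q : nat) (B : 'M[R]_(p, q)) : bool :=
  is_trig_mx B^T.

(* [cols_mx w k] is the matrix with columns w 1, ..., w k (the family w is
   indexed from 1, the columns of a matrix from 0). *)
Definition cols_mx (R : realType) (n : nat) (w : nat -> 'cV[R]_n) (k : nat) :
  'M[R]_(n, k) := \matrix_(i < n, j < k) w j.+1 i 0.

(* Indices are those of the recurrence: u, z, alpha, beta and the
   preconditioners M start at 1, and v starts at v 0 = 0.  Entries that have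
   not been computed yet hold the value 0. *)
Record ffgk_state (R : realType) (m n : nat) := FFGKState {
  ffgk_u : nat -> 'cV[R]_m;
  ffgk_v : nat -> 'cV[R]_n;
  ffgk_z : nat -> 'cV[R]_n;
  ffgk_alpha : nat -> R;
  ffgk_beta : nat -> R
}.

Section FFGK.
Variables (R : realType) (m n : nat).
Variables (A : 'M[R]_(m, n)) (b : 'cV[R]_m) (x0 : 'cV[R]_n).
Variable M : nat -> 'M[R]_n.

Definition ffgk_init : ffgk_state R m n :=
  let r0 := b - A *m x0 in
  let beta1 := enorm r0 in
  FFGKState [fun _ : nat => 0 with 1%N |-> beta1^-1 *: r0]
            (fun=> 0)
            (fun=> 0)
            (fun=> 0)
            [fun _ : nat => 0 with 1%N |-> beta1].

Definition ffgk_step (k : nat) (s : ffgk_state R m n) : ffgk_state R m n :=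
  let: FFGKState u v z alpha beta := s in
  let vhat := A^T *m u k - beta k *: v k.-1 in
  let zhat := invmx (M k) *m vhat in
  let alphak := Num.sqrt (dotp zhat vhat) in
  let vk := alphak^-1 *: vhat in
  let zk := alphak^-1 *: zhat in
  let uhat := A *m zk - \sum_(1 <= j < k.+1) dotp (A *m zk) (u j) *: u j in
  let betak1 := enorm uhat in
  FFGKState [eta u with k.+1 |-> betak1^-1 *: uhat]
            [eta v with k |-> vk]
            [eta z with k |-> zk]
            [eta alpha with k |-> alphak]
            [eta beta with k.+1 |-> betak1].

(* The state after the steps 1, ..., k.  Since 0^-1 = 0 the recursion is total;
   its values are meaningful as long as no alpha or beta divided by is 0. *)
Fixpoint ffgk (k : nat) : ffgk_state R m n :=
  if k is k'.+1 then ffgk_step k (ffgk k') else ffgk_init.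

Definition ffgk_nonstop (K : nat) : Prop :=
  forall k : nat, (1 <= k <= K)%N ->
    ffgk_beta (ffgk K) k != 0 /\ ffgk_alpha (ffgk K) k != 0.

End FFGK.

(* Main.v *)
(* The vectors u_1, ..., u_K are orthonormal by Gram-Schmidt, and
   A z_i = beta_(i+1) u_(i+1) + \sum_(j <= i) n_(j,i) u_j.  Hence, by induction
   on k, alpha_k (v_k, z_i) = (u_k, A z_i) - beta_k (v_(k-1), z_i) vanishes: for
   i < k - 1 both terms are 0, and for i = k - 1 both equal beta_k, because
   (v_(k-1), z_(k-1)) = 1 by the choice of alpha_(k-1). *)
Require Import Defs.
From mathcomp Require Import all_boot all_order all_algebra.
From mathcomp Require Import reals.

Local Open Scope ring_scope.

Import Order.TTheory GRing.Theory Num.Theory.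

Section DotProduct.
Variables (R : realType) (n : nat).
Implicit Types (x y w : 'cV[R]_n) (c : R).

Lemma dotpE x y : dotp x y = \sum_i x i 0 * y i 0.
Proof. by rewrite /dotp mxE; apply: eq_bigr => i _; rewrite mxE. Qed.

Lemma dotpC x y : dotp x y = dotp y x.
Proof. by rewrite !dotpE; apply: eq_bigr => i _; rewrite mulrC. Qed.

Lemma dotpDr x y w : dotp x (y + w) = dotp x y + dotp x w.
Proof. by rewrite /dotp mulmxDr mxE. Qed.

Lemma dotpBr x y w : dotp x (y - w) = dotp x y - dotp x w.
Proof. by rewrite /dotp mulmxBr !mxE. Qed.

Lemma dotpZr x y c : dotp x (c *: y) = c * dotp x y.
Proof. by rewrite /dotp -scalemxAr mxE. Qed.

Lemma dotpBl x y w : dotp (x - y) w = dotp x w - dotp y w.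
Proof. by rewrite dotpC dotpBr !(dotpC w). Qed.

Lemma dotpZl x y c : dotp (c *: x) y = c * dotp x y.
Proof. by rewrite dotpC dotpZr dotpC. Qed.

Lemma dotp_sumr (I : Type) (s : seq I) (P : pred I) x (F : I -> 'cV[R]_n) :
  dotp x (\sum_(i <- s | P i) F i) = \sum_(i <- s | P i) dotp x (F i).
Proof. by rewrite /dotp mulmx_sumr summxE. Qed.

Lemma dotp_normalize x :
  enorm x != 0 -> dotp ((enorm x)^-1 *: x) ((enorm x)^-1 *: x) = 1.
Proof.
move=> x0; rewrite dotpZl dotpZr -[dotp x x]sqr_sqrtr -/(enorm x).
  by rewrite expr2 !mulrA mulfVK // mulVf.
by rewrite dotpE sumr_ge0 // => i _; rewrite -expr2 sqr_ge0.
Qed.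

(* [Num.sqrt] is 0 on negative numbers, so the hypothesis forces (y, x) > 0. *)
Lemma dotp_sqrt_normalize x y (a := Num.sqrt (dotp y x)) :
  a != 0 -> dotp (a^-1 *: x) (a^-1 *: y) = 1.
Proof.
move=> a0; rewrite dotpZl dotpZr dotpC -[dotp y x]sqr_sqrtr -/a.
  by rewrite expr2 !mulrA mulfVK // mulVf.
by rewrite leNgt; apply: contra a0 => yx0; rewrite /a ltr0_sqrtr.
Qed.

End DotProduct.

Lemma dotp_trmx_mul (R : realType) (m n : nat) (A : 'M[R]_(m, n)) u z :
  dotp (A^T *m u) z = dotp u (A *m z).
Proof. by rewrite /dotp trmx_mul trmxK mulmxA. Qed.

Section Recurrence.
Variables (R : realType) (m n : nat) (A : 'M[R]_(m, n)).
Variables (b : 'cV[R]_m) (x0 : 'cV[R]_n) (M : nat -> 'M[R]_n).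

Local Notation st := (ffgk A b x0 M).

(** Step [l] writes entry [l.+1] of [u] and [beta] but entry [l] of [v], [z] and [alpha], so no
    entry changes once computed. The stability lemmas allow all the recurrences to be read off the
    single state [st K]. *)
Lemma ffgk_u_stable k l : (k <= l)%N ->
  ffgk_u (st l) k.+1 = ffgk_u (st k) k.+1.
Proof.
elim: l => [|l IH]; first by case: k.
rewrite leq_eqVlt => /predU1P[->//|kl]; rewrite -IH //=.
by case: (st l) => u v z al be /=; rewrite eqSS ltn_eqF.
Qed.

Lemma ffgk_beta_stable k l : (k <= l)%N ->
  ffgk_beta (st l) k.+1 = ffgk_beta (st k) k.+1.
Proof.
elim: l => [|l IH]; first by case: k.
rewrite leq_eqVlt => /predU1P[->//|kl]; rewrite -IH //=.
by case: (st l) => u v z al be /=; rewrite eqSS ltn_eqF.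
Qed.

Lemma ffgk_vz_stable k l : (k <= l)%N ->
  [/\ ffgk_v (st l) k = ffgk_v (st k) k, ffgk_z (st l) k = ffgk_z (st k) k
    & ffgk_alpha (st l) k = ffgk_alpha (st k) k].
Proof.
elim: l => [|l IH]; first by case: k.
rewrite leq_eqVlt => /predU1P[->//|kl]; have [<- <- <-] := IH kl.
by rewrite /=; case: (st l) => u v z al be /=; rewrite ltn_eqF.
Qed.

Variable K : nat.
Local Notation u := (ffgk_u (st K)).
Local Notation v := (ffgk_v (st K)).
Local Notation z := (ffgk_z (st K)).
Local Notation alpha := (ffgk_alpha (st K)).
Local Notation beta := (ffgk_beta (st K)).

Lemma ffgk_vz_rec k (vhat := A^T *m u k.+1 - beta k.+1 *: v k) : (k < K)%N ->
  [/\ alpha k.+1 = Num.sqrt (dotp (invmx (M k.+1) *m vhat) vhat),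
      v k.+1 = (alpha k.+1)^-1 *: vhat
    & z k.+1 = (alpha k.+1)^-1 *: (invmx (M k.+1) *m vhat)].
Proof.
move=> kK; have [-> -> ->] := ffgk_vz_stable _ _ kK.
rewrite /vhat ffgk_u_stable ?ffgk_beta_stable 1?ltnW //.
have [-> _ _] := ffgk_vz_stable _ _ (ltnW kK).
by rewrite /=; case: (st k) => u' v' z' al be /=; rewrite eqxx.
Qed.

Lemma ffgk_u_rec k (uhat := A *m z k.+1 -
    \sum_(1 <= j < k.+2) dotp (A *m z k.+1) (u j) *: u j) : (k < K)%N ->
  beta k.+2 = enorm uhat /\ u k.+2 = (enorm uhat)^-1 *: uhat.
Proof.
move=> kK; rewrite ffgk_u_stable // ffgk_beta_stable //.
have -> : uhat = A *m z k.+1 - \sum_(1 <= j < k.+2)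
    dotp (A *m z k.+1) (ffgk_u (st k) j) *: ffgk_u (st k) j.
  (* The sum only involves [u] up to index [k.+1], and these vectors are already final in [st k]. *)
  rewrite /uhat; congr (_ - _); apply: eq_big_nat => -[//|j] /andP[_ jk].
  by rewrite !(ffgk_u_stable j) // (leq_trans _ (ltnW kK)).
have [_ -> _] := ffgk_vz_stable _ _ kK.
by rewrite /=; case: (st k) => u' v' z' al be /=; rewrite !eqxx.
Qed.

Hypothesis nonstop : ffgk_nonstop A b x0 M K.

Lemma ffgk_z_precond k : (k < K)%N -> z k.+1 = invmx (M k.+1) *m v k.+1.
Proof. by move=> kK; have [_ -> ->] := ffgk_vz_rec k kK; rewrite scalemxAr. Qed.

Lemma ffgk_dotp_vz k : (k < K)%N -> dotp (v k.+1) (z k.+1) = 1.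
Proof.
move=> kK; have [_] := nonstop k.+1 kK; have [aE -> ->] := ffgk_vz_rec k kK.
by rewrite aE; apply: dotp_sqrt_normalize.
Qed.

Lemma ffgk_u_unit k : (k < K)%N -> dotp (u k.+1) (u k.+1) = 1.
Proof.
move=> kK; have [+ _] := nonstop k.+1 kK; case: k kK => [|k] kK.
  by rewrite ffgk_u_stable // ffgk_beta_stable //; apply: dotp_normalize.
by have [-> ->] := ffgk_u_rec k (ltnW kK); apply: dotp_normalize.
Qed.

(** Gram-Schmidt step solved for [A *m z k.+1]. The bound is [k.+1 < K] because [beta k.+2] must be
    nonzero, which [nonstop] gives only up to index [K]. *)
Lemma ffgk_Az k : (k.+1 < K)%N ->
  A *m z k.+1 = beta k.+2 *: u k.+2 +
    \sum_(1 <= j < k.+2) dotp (A *m z k.+1) (u j) *: u j.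
Proof.
move=> kK; have [+ _] := nonstop k.+2 kK.
have [-> ->] := ffgk_u_rec k (ltnW kK) => be0.
by rewrite scalerA divff // scale1r subrK.
Qed.

Lemma ffgk_u_orth k i : (k < K)%N -> (i < k)%N -> dotp (u k.+1) (u i.+1) = 0.
Proof.
elim/ltn_ind: k i => -[//|k] IH i kK ik.
(* Orthogonality does not depend on the normalizing factor. *)
have [_ ->] := ffgk_u_rec k (ltnW kK); move: (enorm _)^-1 => c.
rewrite dotpZl dotpBl.
rewrite [dotp (\sum_(_ <= _ < _) _) _]dotpC dotp_sumr.
(* The term of index [i.+1] cancels the inner product with [A *m z k.+1]; every other term vanishes
   by induction. *)
rewrite (bigD1_seq i.+1) ?iota_uniq ?mem_index_iota //= dotpZr.
rewrite ffgk_u_unit ?(leq_trans ik (ltnW kK)) // mulr1.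
rewrite big1_seq ?addr0 ?subrr ?mulr0 // => -[|j].
  by rewrite mem_index_iota andbF.
rewrite mem_index_iota eqSS => /andP[ji /= jk]; rewrite dotpZr.
(* [IH] is applied to the larger of the two indices, hence the strong induction and the use of
   symmetry. *)
case: (ltngtP i j) ji => // [ij|ji] _; last first.
  by rewrite IH ?mulr0 // (leq_ltn_trans _ kK) // ltnW.
by rewrite [dotp (u _) _]dotpC IH ?mulr0 // (leq_ltn_trans _ kK) // ltnW.
Qed.

(** This is the upper Hessenberg shape of [U^T A Z], with the betas on the subdiagonal:
    [A *m z i.+1] lies in the span of [u 1], ..., [u i.+2], and only the last of these can be
    [u k.+2]. *)
Lemma ffgk_dotp_uAz k i : (k.+1 < K)%N -> (i <= k)%N ->
  dotp (u k.+2) (A *m z i.+1) = if i == k then beta k.+2 else 0.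
Proof.
move=> kK ik; rewrite ffgk_Az ?(leq_ltn_trans _ kK) // dotpDr dotpZr dotp_sumr.
rewrite big_nat big1 ?addr0 => [|[//|j] /andP[_ ji]]; last first.
  by rewrite dotpZr ffgk_u_orth ?mulr0 // (leq_trans (ji : (j < i.+1)%N)).
case: eqVneq => [->|ik']; first by rewrite ffgk_u_unit // mulr1.
by rewrite ffgk_u_orth ?mulr0 // ltnS ltn_neqAle ik'.
Qed.

Lemma ffgk_v_perp_z k i : (k < K)%N -> (i < k)%N -> perp (v k.+1) (z i.+1).
Proof.
elim: k i => [//|k IH] i kK ik; rewrite /perp.
have [_ -> _] := ffgk_vz_rec k.+1 kK.
rewrite dotpZl dotpBl dotp_trmx_mul ffgk_dotp_uAz // dotpZl.
case: eqVneq => [->|ik'].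
  by rewrite ffgk_dotp_vz ?(ltnW kK) // mulr1 subrr mulr0.
by rewrite IH ?(ltnW kK) ?ltn_neqAle ?ik' // mulr0 subrr mulr0.
Qed.

End Recurrence.

Theorem theorem1 (R : realType) (m n : nat) (A : 'M[R]_(m, n))
    (b : 'cV[R]_m) (x0 : 'cV[R]_n) (M : nat -> 'M[R]_n)
    (M_spd : forall i : nat, (1 <= i)%N -> spd (M i))
    (K : nat) (K_ge2 : (2 <= K)%N)
    (nonstop : ffgk_nonstop A b x0 M K) :
  let v := ffgk_v (ffgk A b x0 M K) in
  let z := ffgk_z (ffgk A b x0 M K) in
  forall k : nat, (2 <= k <= K)%N ->
    (forall i : nat, (1 <= i <= k.-1)%N ->
       perp_wrt (invmx (M i)) (v k) (v i) /\ perp (v k) (z i)) /\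
    is_upper_trig_mx ((cols_mx v k)^T *m cols_mx z k).
Proof.
move=> v z [//|k] /andP[_ kK]; split=> [[//|i] /andP[_ ik]|].
  have vz : perp (v k.+1) (z i.+1) by apply: ffgk_v_perp_z.
  (* Since [z i.+1] is [invmx (M i.+1) *m v i.+1], both orthogonality relations are the same
     equation. *)
  split=> //; rewrite /perp_wrt -ffgk_z_precond //.
  by rewrite (leq_trans ik) // ltnW.
(* Entry [(i, j)] of the transpose, with [i < j], is the inner product of [v j.+1] and [z i.+1]. *)
apply/is_trig_mxP => i j ij; rewrite !mxE.
have vz : perp (v j.+1) (z i.+1).
  by apply: ffgk_v_perp_z => //; apply: leq_trans kK.
by rewrite -[RHS]vz dotpE; apply: eq_bigr => l _; rewrite !mxE.
Qed.
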